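(* For every integer $n\ge 0$, the path $P_{2n+1}$ on $2n+1$ vertices is independence unique, i.e. every graph $G$ with $i(G,x)=i(P_{2n+1},x)$ is isomorphic to $P_{2n+1}$.
   Context: All graphs are finite, undirected and simple. A set of vertices is independent if it induces no edges. The independence polynomial of a graph $G$ is $i(G,x)=\sum_{k\ge 0} i_k x^k$, where $i_k$ is the number of independent sets of size $k$ in $G$. A graph $G$ is independence unique if every graph with the same independence polynomial as $G$ is isomorphic to $G$. *)

(* Defs.v *)
From mathcomp Require Import all_boot all_algebra.

Set Implicit Arguments.
Unset Strict Implicit.
Unset Printing Implicit Defensive.

Record sgraph := SGraph {
  vertex :> finType;
  adj : rel vertex;
  adj_sym : symmetric adj;
  adj_irr : irreflexive adj
}.

Definition independent (G : sgraph) (A : {set G}) : bool :=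
  [forall x in A, forall y in A, ~~ adj x y].

Definition num_indep (G : sgraph) (k : nat) : nat :=
  #|[set A : {set G} | independent A & #|A| == k]|.

(* The sum stops at k = #|G|, since num_indep G k = 0 for k > #|G|. *)
Definition indep_poly (G : sgraph) : {poly int} :=
  (\poly_(k < #|G|.+1) (num_indep G k)%:Z)%R.

Definition isomorphic (G H : sgraph) : Prop :=
  exists2 f : G -> H, bijective f & forall x y : G, adj (f x) (f y) = adj x y.

Definition independence_unique (G : sgraph) : Prop :=
  forall H : sgraph, indep_poly H = indep_poly G -> isomorphic H G.

Definition path_adj (m : nat) : rel 'I_m :=
  fun i j => (i.+1 == j :> nat) || (j.+1 == i :> nat).

Fact path_adj_sym (m : nat) : symmetric (@path_adj m).
Proof. by move=> i j; rewrite /path_adj orbC. Qed.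

Fact path_adj_irr (m : nat) : irreflexive (@path_adj m).
Proof. by move=> i; rewrite /path_adj orbb gtn_eqF. Qed.

Definition path_graph (m : nat) : sgraph :=
  SGraph (@path_adj_sym m) (@path_adj_irr m).

(* Main.v *)
Require Import Defs.
From mathcomp Require Import all_boot all_algebra.
From mathcomp Require Import zify.

(* The path has a single independent set of size n+1, hence so does an equivalent
   graph H; call it A. By uniqueness every vertex outside A has at least two
   neighbours in A. As there are n such vertices and only 2n edges, each has
   exactly two neighbours, both in A: H is bipartite, hence triangle-free.
   For triangle-free graphs i_1, i_2, i_3 determine the sum of the squared
   degrees, so the sum of (d-1)(d-2) vanishes as it does for the path, and all
   degrees are at most 2. A nonempty union S of components of H satisfies
   |S \ A| < |S & A|, since otherwise swapping A and its complement inside S gives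
   a second set of size n+1; as |A| = |V \ A| + 1, H is connected. A connected
   graph with 2n edges on 2n+1 vertices and degrees at most 2 is a path. *)

Set Implicit Arguments.
Unset Strict Implicit.
Unset Printing Implicit Defensive.

(** * Independent sets of sizes one, two and three *)

Section Counting.

Variable G : sgraph.
Implicit Types (x y z : G) (A S : {set G}).

Definition nbr x : {set G} := [set y | adj x y].

(** The neighbourhood of [x] in the complement graph. *)
Definition conbr x : {set G} := [set y | (x != y) && ~~ adj x y].

(** The restriction to [S] lets the recursion [indep_inS] be iterated: once a vertex is chosen, the
    remaining ones are sought in a smaller set. *)
Definition indep_in S k : nat :=
  #|[set A : {set G} | [&& A \subset S, independent A & #|A| == k]]|.

Lemma independentP A :
  reflect {in A &, forall x y, ~~ adj x y} (independent A).
Proof.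
apply: (iffP forall_inP) => [h x y xA yA | h x xA].
  by move/forall_inP: (h x xA); apply.
by apply/forall_inP => y yA; apply: h.
Qed.

Lemma indep_in_setT k : indep_in setT k = num_indep G k.
Proof.
by rewrite /indep_in /num_indep; apply: eq_card => A; rewrite !inE subsetT.
Qed.

Lemma indep_in0 S : indep_in S 0 = 1.
Proof.
rewrite /indep_in -[RHS](cards1 (set0 : {set G})); apply: eq_card => A.
rewrite !inE cards_eq0; case: eqP => [->|]; last by rewrite !andbF.
by rewrite sub0set andbT; apply/independentP => x y; rewrite inE.
Qed.

(* Both sides count the pairs (x, A) with x in an independent A of size k.+1. *)
Lemma indep_inS S k :
  k.+1 * indep_in S k.+1 = \sum_(x in S) indep_in (S :&: conbr x) k.
Proof.
rewrite /indep_in mulnC -sum_nat_const.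
rewrite (eq_bigr (fun A => \sum_(x in A) 1)); last first.
  by move=> A; rewrite inE sum1_card => /and3P[_ _ /eqP].
rewrite (exchange_big_dep (mem S)) /=; last first.
  by move=> A x; rewrite inE => /and3P[/subsetP AS _ _] /AS.
apply: eq_bigr => x xS; rewrite sum1dep_card.
(* Deleting [x] is a bijection from the sets containing [x] to the independent subsets of
   [S :&: conbr x]. *)
rewrite -[LHS](@card_in_imset _ _ (fun A : {set G} => A :\ x)); last first.
  move=> A B; rewrite !inE => /andP[_ xA] /andP[_ xB] AB.
  by rewrite -(setD1K xA) AB setD1K.
apply: eq_card => B; rewrite [RHS]inE; apply/imsetP/and3P.
  case=> A; rewrite !inE => /andP[/and3P[/subsetP AS /independentP iA cA] xA ->].
  split.
  - apply/subsetP => y; rewrite !inE => /andP[yx yA].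
    by rewrite AS // eq_sym yx iA.
  - by apply/independentP => y z; rewrite !inE => /andP[_ yA] /andP[_ zA]; apply: iA.
  - by rewrite (cardsD1 x) xA in cA.
case=> /subsetP BS /independentP iB cB.
have xB : x \notin B by apply/negP => /BS; rewrite !inE eqxx andbF.
exists (x |: B); last by rewrite setU1K.
rewrite !inE eqxx andbT; apply/and3P; split.
- apply/subsetP => y; rewrite !inE => /predU1P[-> //|/BS].
  by rewrite inE => /andP[].
- apply/independentP => y z; rewrite !inE => /predU1P[->|yB] /predU1P[->|zB].
  + by rewrite adj_irr.
  + by move/BS: zB; rewrite !inE => /and3P[].
  + by rewrite adj_sym; move/BS: yB; rewrite !inE => /and3P[].
  + exact: iB.
- by rewrite cardsU1 xB add1n eqSS.
Qed.

Lemma indep_in1 S : indep_in S 1 = #|S|.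
Proof.
rewrite -[LHS]mul1n indep_inS (eq_bigr (fun=> 1)) ?sum1_card // => x _.
exact: indep_in0.
Qed.

Lemma num_indep1 : num_indep G 1 = #|G|.
Proof. by rewrite -indep_in_setT indep_in1 cardsT. Qed.

Lemma card_conbr x : #|conbr x| + #|nbr x| + 1 = #|G|.
Proof.
rewrite -cardsT -(cardsID [set x] setT) setTI cards1 addnC; congr addn.
rewrite -(cardsID (nbr x) (_ :\: _)) addnC; congr addn; apply: eq_card => y.
  by rewrite !inE; case: eqP => [->|]; rewrite ?adj_irr // andbT.
rewrite !inE andbT eq_sym; by rewrite andbC.
Qed.


(** Pairs of size two are the edges of the complement graph, so [card_conbr] is summed over all
    vertices. Thus i_1 and i_2 determine the degree sum. *)
Lemma num_indep2 :
  2 * num_indep G 2 + \sum_x #|nbr x| + #|G| = #|G| * #|G|.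
Proof.
rewrite -indep_in_setT indep_inS big_mkcond /=.
rewrite (eq_bigr (fun x => #|conbr x|)); last first.
  by move=> x _; rewrite inE indep_in1 setTI.
rewrite -[#|G| in LHS]sum1_card -!big_split /=.
by rewrite (eq_bigr (fun=> #|G|)) ?sum_nat_const // => x _; apply: card_conbr.
Qed.

(** Inclusion-exclusion: the vertices outside both [conbr x] and [conbr y] are [x], [y] and the
    union of the two neighbourhoods, which contains neither [x] nor [y]. *)
Lemma card_conbrI x y : y \in conbr x ->
  #|conbr x :&: conbr y| + #|nbr x| + #|nbr y| + 2 = #|G| + #|nbr x :&: nbr y|.
Proof.
rewrite inE => /andP[xy nxy].
have xyN : [set x; y] :&: (nbr x :|: nbr y) = set0.
  apply/setP => z; rewrite !inE; case: eqP => [->|_].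
    by rewrite adj_irr adj_sym (negPf nxy).
  by case: eqP => // ->; rewrite adj_irr (negPf nxy).
have cN : ~: (conbr x :&: conbr y) = [set x; y] :|: (nbr x :|: nbr y).
  apply/setP => z; rewrite !inE !negb_and !negbK (eq_sym x) (eq_sym y).
  by case: (z == x); case: (z == y); case: (adj x z).
have := cardsC (conbr x :&: conbr y).
have := cardsUI [set x; y] (nbr x :|: nbr y).
have := cardsUI (nbr x) (nbr y).
rewrite cN xyN cards0 cards2 xy; lia.
Qed.

Hypothesis trifree : forall x y z, adj x y -> adj y z -> ~~ adj x z.

(** Both sides count walks of length two from [x], by endpoint [y] and by midpoint [z]. The endpoint
    [x] accounts for [#|nbr x|] walks, and without triangles no walk ends at a neighbour of [x]. *)
Lemma sum_card_nbrI x :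
  \sum_(y in conbr x) #|nbr x :&: nbr y| + #|nbr x| = \sum_(z in nbr x) #|nbr z|.
Proof.
have <- : \sum_y #|nbr x :&: nbr y| = \sum_(z in nbr x) #|nbr z|.
  rewrite (eq_bigr (fun y => \sum_(z in nbr x) (adj y z : nat))); last first.
    move=> y _; rewrite -sum1_card big_mkcond [RHS]big_mkcond /=.
    by apply: eq_bigr => z _; rewrite !inE; case: (adj x z); case: (adj y z).
  rewrite exchange_big; apply: eq_bigr => z _.
  rewrite -sum1_card [RHS]big_mkcond; apply: eq_bigr => y _.
  by rewrite inE adj_sym; case: adj.
rewrite [RHS](bigID (mem (conbr x))) /=; congr addn.
rewrite [RHS](bigD1 x) /=; last by rewrite inE eqxx.
rewrite setIid big1 ?addn0 // => y; rewrite inE.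
rewrite negb_and !negbK eq_sym => /andP[/orP[->//|xy] _].
apply/eqP; rewrite cards_eq0; apply/eqP/setP => z; rewrite !inE.
by apply/negbTE; rewrite negb_and orbC -implybE; apply/implyP; apply: trifree.
Qed.

(** Sum [card_conbrI] over ordered pairs of distinct non-adjacent vertices. The common neighbours
    then add up to walks of length two, which brings in the squared degrees. *)
Lemma num_indep3 :
  6 * num_indep G 3 + 2 * (#|G| * \sum_x #|nbr x|) + 4 * num_indep G 2 =
  2 * (#|G| * num_indep G 2) + 3 * (\sum_x #|nbr x| ^ 2) + \sum_x #|nbr x|.
Proof.
have c2 : 2 * num_indep G 2 = \sum_x #|conbr x|.
  rewrite -indep_in_setT indep_inS big_mkcond /=.
  by apply: eq_bigr => x _; rewrite inE indep_in1 setTI.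
have i3 : 6 * num_indep G 3 =
    \sum_x \sum_(y in conbr x) #|conbr x :&: conbr y|.
  rewrite -indep_in_setT -[6]/(2 * 3) -mulnA indep_inS big_distrr big_mkcond /=.
  apply: eq_bigr => x _; rewrite inE setTI indep_inS.
  by apply: eq_bigr => y _; rewrite indep_in1.
have sq : \sum_x \sum_(z in nbr x) #|nbr z| = \sum_x #|nbr x| ^ 2.
  rewrite (exchange_big_dep predT) //=; apply: eq_bigr => z _.
  rewrite sum_nat_const -mulnn; congr muln; apply: eq_card => x.
  by rewrite -[LHS]/(z \in nbr x) !inE adj_sym.
have cod : \sum_x \sum_(y in conbr x) #|nbr x :&: nbr y| + \sum_x #|nbr x|
   = \sum_x #|nbr x| ^ 2.
  by rewrite -sq -big_split; apply: eq_bigr => x _; apply: sum_card_nbrI.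
have dc : \sum_x \sum_(y in conbr x) #|nbr y| = \sum_x #|conbr x| * #|nbr x|.
  rewrite (exchange_big_dep predT) //=; apply: eq_bigr => z _.
  rewrite sum_nat_const; congr muln; apply: eq_card => x.
  by rewrite -[LHS]/(z \in conbr x) !inE eq_sym adj_sym.
have cc : \sum_x #|conbr x| * #|nbr x| + \sum_x #|nbr x| ^ 2 + \sum_x #|nbr x|
    = #|G| * \sum_x #|nbr x|.
  rewrite big_distrr -!big_split /=; apply: eq_bigr => x _.
  by rewrite -(card_conbr x); lia.
have : \sum_x \sum_(y in conbr x) (#|conbr x :&: conbr y| + #|nbr x| + #|nbr y| + 2)
   = \sum_x \sum_(y in conbr x) (#|G| + #|nbr x :&: nbr y|).
  by apply: eq_bigr => x _; apply: eq_bigr => y; apply: card_conbrI.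
under eq_bigr do rewrite !big_split !sum_nat_const /=.
under [RHS]eq_bigr do rewrite big_split sum_nat_const /=.
rewrite !big_split -!big_distrl /= -i3 -c2 dc.
move: cod cc; do ![set s := (\sum_x _); move: s => ?].
by clear; move: #|G| (num_indep _ _) (num_indep _ _) => ? ? ?; lia.
Qed.

End Counting.

(** * Structure forced by a unique independent set of its size *)

Lemma exchange_nbr (G : sgraph) (S T : {set G}) :
  \sum_(x in S) #|nbr x :&: T| = \sum_(y in T) #|nbr y :&: S|.
Proof.
have sumE (U W : {set G}) : \sum_(x in U) #|nbr x :&: W|
    = \sum_(x in U) \sum_(y in W) (adj x y : nat).
  apply: eq_bigr => x _; rewrite -sum1_card big_mkcond [RHS]big_mkcond /=.
  by apply: eq_bigr => y _; rewrite !inE andbC; case: (y \in W) => //=; case: adj.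
rewrite !sumE exchange_big; apply: eq_bigr => y _.
by apply: eq_bigr => x _; rewrite adj_sym.
Qed.

Section UniqueMaximumIndependentSet.

Variables (G : sgraph) (A : {set G}).
Hypothesis indepA : independent A.
Hypothesis uniqA : forall A' : {set G}, independent A' -> #|A'| = #|A| -> A' = A.
Hypothesis cardA : #|A| = #|~: A| + 1.
Hypothesis sum_deg : \sum_(x : G) #|nbr x| = 4 * #|~: A|.

Lemma nbr_indep a : a \in A -> nbr a :&: A = set0.
Proof.
move=> aA; apply/setP => x; rewrite !inE; apply/negbTE.
by rewrite negb_and orbC -implybE; apply/implyP => xA; move/independentP: indepA; apply.
Qed.

(* Otherwise exchanging b with its only neighbour in A, or with any element of
   A if it has none, gives another independent set of the same size. *)
Lemma two_nbrs b : b \notin A -> 2 <= #|nbr b :&: A|.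
Proof.
move=> bA; rewrite ltnNge; apply/negP => le1.
have [a aA Na] : exists2 a, a \in A & nbr b :&: A \subset [set a].
  have [N0|[a aN]] := set_0Vmem (nbr b :&: A).
    have /card_gt0P[a aA] : 0 < #|A| by rewrite cardA addn1.
    by exists a => //; rewrite N0 sub0set.
  exists a; first by move: aN; rewrite inE => /andP[].
  apply/subsetP => x xN; rewrite inE; apply/eqP.
  by move/card_le1_eqP: le1; apply.
have nadj x : x \in A :\ a -> ~~ adj b x.
  rewrite !inE => /andP[xa xA]; apply: contra xa => bx.
  by move/subsetP/(_ x): Na; rewrite !inE bx xA; apply.
have bA' : b \notin A :\ a by rewrite inE (negPf bA) andbF.
suff /setP/(_ b) : b |: A :\ a = A by rewrite !inE eqxx (negPf bA).
apply: uniqA; last by rewrite cardsU1 bA' (cardsD1 a A) aA.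
apply/independentP => x y; rewrite !in_setU1.
move=> /predU1P[->|xA] /predU1P[->|yA]; rewrite ?adj_irr ?nadj //.
  by rewrite adj_sym nadj.
by move/setD1P: xA => [_ xA]; move/setD1P: yA => [_ yA]; move/independentP: indepA; apply.
Qed.

(** Write B for the complement of [A], e for the number of edges between [A] and B, and f for the
    degree sum inside B. Then 2e + f = 4|B|, while [two_nbrs] gives e >= 2|B|. Hence f = 0 and no
    vertex of B has a third neighbour in [A]. *)
Lemma nbr_compl b : b \notin A -> #|nbr b| = 2 /\ nbr b \subset A.
Proof.
have sA : \sum_(x in A) #|nbr x| = \sum_(x in ~: A) #|nbr x :&: A|.
  rewrite exchange_nbr; apply: eq_bigr => x xA.
  by rewrite -(cardsID A (nbr x)) nbr_indep // cards0 setDE.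
have sB : \sum_(x in ~: A) #|nbr x|
    = \sum_(x in ~: A) #|nbr x :&: A| + \sum_(x in ~: A) #|nbr x :\: A|.
  by rewrite -big_split; apply: eq_bigr => x _; rewrite /= cardsID.
have s2 : \sum_(x in ~: A) #|nbr x :&: A|
    = 2 * #|~: A| + \sum_(x in ~: A) (#|nbr x :&: A| - 2).
  rewrite mulnC -sum_nat_const -big_split; apply: eq_bigr => x xB.
  by rewrite /= subnKC // two_nbrs // -in_setC.
have sC : \sum_(x : G) #|nbr x| = \sum_(x in A) #|nbr x| + \sum_(x in ~: A) #|nbr x|.
  by rewrite (bigID (mem A)) /=; congr addn; apply: eq_bigl => x; rewrite inE.
have /eqP : \sum_(x in ~: A) (#|nbr x :&: A| - 2)
    + \sum_(x in ~: A) #|nbr x :\: A| = 0.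
  move: sC sB; rewrite sum_deg sA s2; lia.
rewrite addn_eq0 !sum_nat_eq0 => /andP[/forall_inP h1 /forall_inP h2] bA.
have bB : b \in ~: A by rewrite inE.
have := h2 _ bB; rewrite cards_eq0 setD_eq0 => sbA; split=> //.
have := h1 _ bB; rewrite subn_eq0 (setIidPl sbA) => le2.
by apply/eqP; rewrite eqn_leq le2 -{1}(setIidPl sbA) two_nbrs.
Qed.

(** Every edge joins [A] to its complement, and a closed walk of length three cannot change sides at
    each step. *)
Lemma triangle_free (x y z : G) : adj x y -> adj y z -> ~~ adj x z.
Proof.
have adjA u v : adj u v -> (u \in A) = (v \notin A).
  move=> uv; have [uA|uA] := boolP (u \in A).
    by apply/esym; apply: contraL uv => vA; move/independentP: indepA; apply.
  have [_ /subsetP/(_ v)] := nbr_compl uA.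
  by rewrite inE => /(_ uv) ->.
move=> /adjA xy /adjA yz; apply/negP => /adjA xz.
by move: xy yz xz; case: (x \in A); case: (y \in A); case: (z \in A).
Qed.

Hypothesis deg2 : forall x : G, #|nbr x| <= 2.

Lemma closed_card_lt (S : {set G}) : S != set0 ->
  {in S, forall x, nbr x \subset S} -> #|S :\: A| < #|S :&: A|.
Proof.
move=> S0 clS; rewrite ltnNge; apply/negP => le.
(* Count edges between the two parts of [S]: two at each vertex outside [A], at most two at each
   vertex in [A]. *)
have le' : #|S :\: A| <= #|S :&: A|.
  have : \sum_(x in S :\: A) #|nbr x :&: (S :&: A)| <= \sum_(x in S :&: A) 2.
    rewrite exchange_nbr leq_sum // => x _.
    by apply: leq_trans (deg2 x); rewrite subset_leq_card // subsetIl.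
  rewrite (eq_bigr (fun=> 2)) ?sum_nat_const ?leq_pmul2r // => x.
  rewrite inE => /andP[xA xS]; have [<- sA] := nbr_compl xA.
  by rewrite (setIidPl _) // subsetI clS.
have eqc : #|S :\: A| = #|S :&: A| by apply/eqP; rewrite eqn_leq le'.
(* With equal parts, the exchange inside [S] preserves size and independence, but changes membership
   of every vertex of [S]. *)
pose A' := (A :\: S) :|: (S :\: A).
have cA' : #|A'| = #|A|.
  rewrite cardsU (_ : _ :&: _ = set0) ?cards0 ?subn0.
    by rewrite eqc setIC addnC cardsID.
  by apply/setP => x; rewrite !inE; case: (x \in A); case: (x \in S).
have iA' : independent A'.
  have compl_nadj x y : x \in S :\: A -> y \in A' -> ~~ adj x y.
    rewrite inE => /andP[xA xS] yA'; apply/negP => xy.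
    have [_ /subsetP/(_ y)] := nbr_compl xA; rewrite inE => /(_ xy) yA.
    have /subsetP/(_ y) := clS _ xS; rewrite inE => /(_ xy) yS.
    by move: yA'; rewrite !inE yA yS.
  apply/independentP => x y xA' yA'; move: (xA').
  rewrite inE => /orP[xA|xB]; last exact: compl_nadj.
  move: (yA'); rewrite inE => /orP[yA|yB]; last by rewrite adj_sym compl_nadj.
  move: xA yA; rewrite !inE => /andP[_ xA] /andP[_ yA].
  by move/independentP: indepA; apply.
case/set0Pn: S0 => x xS; move/setP/(_ x): (uniqA iA' cA').
by rewrite !inE xS; case: (x \in A).
Qed.

(** If [S] were proper, [S] and its complement would each have a surplus of at least one in [A], but
    the total surplus is one. *)
Lemma closed_setT (S : {set G}) : S != set0 ->
  {in S, forall x, nbr x \subset S} -> S = setT.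
Proof.
move=> S0 clS; apply/eqP/negPn/negP => ST.
have C0 : ~: S != set0 by rewrite -(inj_eq (@setC_inj _)) setCK setC0.
have lt1 := closed_card_lt S0 clS.
have /(closed_card_lt C0) lt2 : {in ~: S, forall x, nbr x \subset ~: S}.
  move=> x; rewrite inE => xS; apply/subsetP => y; rewrite !inE => xy.
  by apply: contra xS => /clS/subsetP; apply; rewrite inE adj_sym.
move: lt1 lt2; rewrite !setDE !(setIC S) !(setIC (~: S)) -!setDE.
have := cardsID S A; have := cardsID S (~: A); rewrite cardA; lia.
Qed.

End UniqueMaximumIndependentSet.

(** * Recognising a path by degrees and connectedness *)

Lemma isomorphic_path_graph (G : sgraph) (v0 : G) :
  #|nbr v0| <= 1 -> (forall x : G, #|nbr x| <= 2) ->
  (forall S : {set G}, S != set0 -> {in S, forall x, nbr x \subset S} -> S = setT) ->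
  isomorphic G (path_graph #|G|).
Proof.
move=> deg1 deg2 conn.
(* A longest simple path from [v0] is taken; [k] counts its edges. *)
pose has_path k := [exists p : k.-tuple G, path (@adj G) v0 p && uniq (v0 :: p)].
have ex_path : exists k, has_path k.
  by exists 0; apply/existsP; exists [tuple].
have bound k : has_path k -> k <= #|G|.
  case/existsP => p /andP[_ /= /andP[_ /card_uniqP]].
  by rewrite size_tuple => <-; apply: max_card.
have [k /existsP[p /andP[pathp uniqs]] maxk] := ex_maxnP ex_path bound.
pose s := v0 :: p.
have szs : size s = k.+1 by rewrite /= size_tuple.
have step i : i < k -> adj (nth v0 s i) (nth v0 s i.+1).
  by move=> ik; move/(pathP v0): pathp; apply; rewrite size_tuple.
have nth_inj i j : i <= k -> j <= k -> nth v0 s i = nth v0 s j -> i = j.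
  by move=> ik jk /eqP; rewrite nth_uniq ?szs // => /eqP.
(* Before the last vertex, the degree bounds are already exhausted by the neighbours along the
   path. *)
have nbr_nth i y : i < k -> adj (nth v0 s i) y ->
    y = nth v0 s i.+1 \/ exists2 j, j < i & y = nth v0 s j.
  case: i => [|i] ik iy.
    left; move/card_le1_eqP: deg1; apply; rewrite inE //; exact: (step 0).
  have ne : nth v0 s i != nth v0 s i.+2.
    by apply/eqP => /nth_inj; rewrite (ltnW (ltnW ik)) ik; lia.
  have sub : [set nth v0 s i; nth v0 s i.+2] \subset nbr (nth v0 s i.+1).
    by rewrite subUset !sub1set !inE step // adj_sym step // ltnW.
  have /eqP E : [set nth v0 s i; nth v0 s i.+2] == nbr (nth v0 s i.+1).
    by rewrite eqEcard sub cards2 ne deg2.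
  have : y \in nbr (nth v0 s i.+1) by rewrite inE.
  by rewrite -E !inE => /orP[] /eqP ->; [right; exists i | left].
have closed_s : [set x in s] = setT.
  apply: conn; first by apply/set0Pn; exists v0; rewrite !inE eqxx.
  move=> x; rewrite in_set => /(nthP v0)[i]; rewrite szs ltnS leq_eqVlt => ik <-.
  apply/subsetP => y; rewrite /nbr !in_set => iy.
  case/orP: ik => [/eqP ik|ik]; last first.
    have [->|[j ji ->]] := nbr_nth _ _ ik iy; apply: mem_nth; rewrite szs; lia.
  (* A neighbour of the last vertex lying off the path would prolong it. *)
  apply/negPn/negP => ys; suff : k.+1 <= k by rewrite ltnn.
  apply: maxk; apply/existsP; exists [tuple of rcons p y].
  rewrite -[v0 :: _]/(rcons s y) rcons_uniq ys uniqs rcons_path pathp !andbT.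
  by rewrite (last_nth v0) size_tuple; move: iy; rewrite ik.
have mem_s x : x \in s by move/setP/(_ x): closed_s; rewrite !inE.
have cG : #|G| = k.+1.
  by rewrite -szs -(card_uniqP uniqs) -cardsT -closed_s cardsE.
have lt_index x : index x s < #|G| by rewrite cG -szs index_mem.
exists (fun x => Ordinal (lt_index x)).
  apply: inj_card_bij; last by rewrite card_ord.
  move=> x y fxy; have E : index x s = index y s := congr1 val fxy.
  by rewrite -(nth_index v0 (mem_s x)) E nth_index.
have adj_index x y : adj x y -> index x s < index y s -> index y s = (index x s).+1.
  move=> xy lt; have ltk : index x s < k.
    by have := lt_index y; rewrite cG ltnS; apply: leq_trans.
  have := nbr_nth _ y ltk; rewrite nth_index // => /(_ xy) [E|[j ji E]].
    by rewrite {1}E index_uniq ?szs.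
  by move: lt; rewrite E index_uniq // ?szs; lia.
move=> x y; rewrite [LHS]/((_ == index y s) || (_ == index x s)).
apply/orP/idP => [[] /eqP E|xy].
- by have := lt_index y; rewrite cG -E ltnS => /step; rewrite E !nth_index.
- by have := lt_index x; rewrite cG -E ltnS => /step; rewrite E !nth_index // adj_sym.
case: (ltngtP (index x s) (index y s)) => lt.
- by left; apply/eqP; rewrite (adj_index x y).
- by right; apply/eqP; rewrite (adj_index y x) // adj_sym.
- by move: xy; rewrite -(nth_index v0 (mem_s x)) lt nth_index // adj_irr.
Qed.

(** * Coefficients of the polynomial, and invariants of the path *)

Lemma coef_indep_poly (G : sgraph) k : ((indep_poly G)`_k)%R = (num_indep G k)%:Z%R.
Proof.
rewrite coef_poly ltnS; case: leqP => // ltk.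
rewrite /num_indep (_ : [set A | _] = set0) ?cards0 //.
apply/setP => A; rewrite !inE; apply/negbTE; rewrite negb_and.
by rewrite [_ == k]ltn_eqF ?orbT // (leq_ltn_trans (max_card _)).
Qed.

Lemma path_graph_deg m (i : path_graph m) : #|nbr i| = (0 < i) + (i.+1 < m).
Proof.
have -> : nbr i = [set j : 'I_m | j.+1 == i] :|: [set j : 'I_m | i.+1 == j].
  by apply/setP => j; rewrite !inE orbC.
rewrite cardsU (_ : _ :&: _ = set0) ?cards0 ?subn0; last first.
  by apply/setP => j; rewrite !inE; apply/negbTE; lia.
congr addn.
  case: i => [[|i] lti] /=; first by apply: eq_card0 => j; rewrite !inE.
  rewrite -[RHS](cards1 (Ordinal (ltnW lti))); apply: eq_card => j.
  by rewrite !inE eqSS.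
have [lti|lei] := boolP (i.+1 < m).
  by rewrite -[RHS](cards1 (Ordinal lti)); apply: eq_card => j; rewrite !inE eq_sym.
by apply: eq_card0 => j; rewrite !inE; apply/negbTE; have := ltn_ord j; lia.
Qed.

Lemma path_graph_sum_deg k : \sum_(i : path_graph k.+1) #|nbr i| = 2 * k.
Proof.
under eq_bigr do rewrite path_graph_deg.
rewrite big_split /= [X in X + _]big_ord_recl [X in _ + X]big_ord_recr /=.
rewrite ltnn addn0 add0n mul2n -addnn; congr addn.
  by rewrite (eq_bigr (fun=> 1)) ?sum1_card ?card_ord.
by rewrite (eq_bigr (fun=> 1)) ?sum1_card ?card_ord // => i _; rewrite ltnS ltn_ord.
Qed.

Lemma path_graph_triangle_free m (x y z : path_graph m) :
  adj x y -> adj y z -> ~~ adj x z.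
Proof. rewrite /= /path_adj; lia. Qed.

(** Cut the path into the n blocks {2j, 2j+1} and the last block {2n}. An independent set meets each
    block at most once, so one of size n+1 meets each exactly once. *)
Lemma num_indep_path n : num_indep (path_graph (2 * n + 1)) n.+1 = 1.
Proof.
have ltE (j : 'I_n.+1) : 2 * j < 2 * n + 1 by have := ltn_ord j; lia.
pose E : {set path_graph (2 * n + 1)} := [set Ordinal (ltE j) | j : 'I_n.+1].
have injE : injective (fun j => Ordinal (ltE j)).
  by move=> i j [] ij; apply: val_inj => /=; lia.
have cE : #|E| = n.+1 by rewrite card_imset // card_ord.
rewrite /num_indep -[RHS](cards1 E).
apply: eq_card => A; rewrite !inE; apply/andP/eqP => [[/independentP iA /eqP cA]|->].
  apply/esym/eqP; rewrite eqEcard cE cA leqnn andbT.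
  have lth (i : path_graph (2 * n + 1)) : i./2 < n.+1 by have := ltn_ord i; lia.
  pose h i := Ordinal (lth i).
  have hinj : {in A &, injective h}.
    move=> x y xA yA [] xy; apply: val_inj; have := iA x y xA yA.
    by rewrite /= /path_adj; lia.
  have hA j : exists2 i, i \in A & h i = j.
    have : h @: A = setT.
      by apply/eqP; rewrite eqEcard subsetT cardsT card_ord card_in_imset // cA leqnn.
    by move/setP/(_ j); rewrite in_setT => /imsetP[i iA' ->]; exists i.
  (* Downward induction on the block: the last one leaves only 2n, and if 2j+2 is chosen then 2j+1
     is excluded, which leaves 2j. *)
  have evenA k (j : 'I_n.+1) : j + k = n -> Ordinal (ltE j) \in A.
    elim: k j => [|k IH] j jk.
      have [i iA' hi] := hA j; suff <- : i = Ordinal (ltE j) by [].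
      by apply: val_inj => /=; move: (congr1 val hi) (ltn_ord i) => /=; lia.
    have ltj : j.+1 < n.+1 by lia.
    have /IH nA : Ordinal ltj + k = n by move=> /=; lia.
    have [i iA' hi] := hA j; suff <- : i = Ordinal (ltE j) by [].
    apply: val_inj => /=; move: (congr1 val hi) (iA _ _ iA' nA) => /=.
    by rewrite /path_adj /=; lia.
  apply/subsetP => _ /imsetP[j _ ->]; apply: (evenA (n - j)).
  by rewrite subnKC // -ltnS.
rewrite cE; split=> //; apply/independentP => _ _ /imsetP[i _ ->] /imsetP[j _ ->].
by rewrite /= /path_adj /=; lia.
Qed.

(** * Independence uniqueness of odd paths *)

Theorem theorem6 (n : nat) : independence_unique (path_graph (2 * n + 1)).
Proof.
set P := path_graph (2 * n + 1) => H HP.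
have eqi k : num_indep H k = num_indep P k.
  by apply/eqP; rewrite -eqz_nat -!coef_indep_poly HP.
have cP : #|P| = 2 * n + 1 by rewrite card_ord.
have cH : #|H| = 2 * n + 1 by rewrite -num_indep1 eqi num_indep1.
have sumP : \sum_(x : P) #|nbr x| = 4 * n.
  by rewrite /P addn1 path_graph_sum_deg mulnA.
have sumH : \sum_(x : H) #|nbr x| = 4 * n.
  by have := num_indep2 H; have := num_indep2 P; rewrite eqi cP cH sumP; lia.
have [A EA] : exists A : {set H}, [set B : {set H} | independent B & #|B| == n.+1] = [set A].
  by apply/cards1P; rewrite -[_ == 1]/(num_indep H n.+1 == 1) eqi num_indep_path.
have /setIdP[indepA /eqP sizeA] : A \in [set B : {set H} | independent B & #|B| == n.+1].
  by rewrite EA set11.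
have uniqA (B : {set H}) : independent B -> #|B| = #|A| -> B = A.
  by move=> iB cB; apply/set1P; rewrite -EA inE iB cB sizeA eqxx.
have sizeCA : #|~: A| = n by have := cardsC A; rewrite sizeA cH; lia.
have cardA : #|A| = #|~: A| + 1 by rewrite sizeA sizeCA addn1.
have sumA : \sum_(x : H) #|nbr x| = 4 * #|~: A| by rewrite sizeCA.
have sq : \sum_(x : H) #|nbr x| ^ 2 = \sum_(x : P) #|nbr x| ^ 2.
  have := num_indep3 (triangle_free indepA uniqA cardA sumA).
  have := num_indep3 (@path_graph_triangle_free (2 * n + 1)).
  by rewrite -/P !eqi cP cH sumP sumH; lia.
have deg2 (x : H) : #|nbr x| <= 2.
  (* The single vertex has degree 0, where (d-1)(d-2) does not vanish, so n = 0 is separate. *)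
  have [n0|n0] := posnP n.
    by move/eqP: sumH; rewrite n0 sum_nat_eq0 => /forallP/(_ x) /eqP ->.
  have sqP : \sum_(x : P) (#|nbr x| ^ 2 + 2) = \sum_(x : P) 3 * #|nbr x|.
    apply: eq_bigr => i _; rewrite path_graph_deg; have := ltn_ord i.
    by case: (posnP i) => i0; case: (ltnP i.+1) => //; lia.
  (* Since (d - 1)(d - 2) >= 0 for every natural number d, a vanishing sum of
     these terms forces each degree to be 1 or 2. *)
  have le d : 3 * d <= d ^ 2 + 2 by case: d => [|[|d]] //; nia.
  have : \sum_(x : H) (#|nbr x| ^ 2 + 2 - 3 * #|nbr x|) == 0.
    rewrite sumnB // subn_eq0 big_split sum_nat_const /= -!big_distrr /= sq.
    move: sqP; rewrite big_split sum_nat_const /= -!big_distrr /= sumP sumH cP cH.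
    by lia.
  rewrite sum_nat_eq0 => /forallP/(_ x) /=.
  by case: #|nbr x| => [|[|[|d]]] //; nia.
(* The average degree 4n/(2n+1) is below 2; [v0] will be an end of the path. *)
have [v0 deg1] : exists v0 : H, #|nbr v0| <= 1.
  apply/existsP; apply: contraT; rewrite negb_exists => /forallP deg_gt1.
  have : \sum_(x : H) 2 <= \sum_(x : H) #|nbr x|.
    by apply: leq_sum => x _; rewrite ltnNge.
  by rewrite sum_nat_const sumH cH; lia.
rewrite /P -cH; apply: (isomorphic_path_graph deg1 deg2).
exact: (closed_setT indepA uniqA cardA sumA deg2).
Qed.
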